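(* Let $(\star)$ be a linear system over $\mathbb{F}_q$ with coefficient matrix $A\in\mathbb{F}_q^{m\times k}$ which is of type (RC), non-degenerate and irreducible, and let $\ell$ be its number of column equivalence classes. Suppose that at least one of the following holds: (i) none of the column equivalence classes sums to zero, and $\ell=m+1$; (ii) every column equivalence class sums to zero. Then $(\star)$ is temperate.
   Context: Let $\mathbb{F}_q$ be a finite field with $q$ elements. A linear system $(\star)$ with coefficient matrix $A=(a_{ij})\in\mathbb{F}_q^{m\times k}$ is the system $a_{i1}x_1+\cdots+a_{ik}x_k=0$ ($i\in[m]$); a solution is a $k$-tuple $(x_1,\dots,x_k)\in(\mathbb{F}_q^n)^k$ satisfying all of them. A linear equation $b_1x_1+\dots+b_kx_k=0$ ($b\in\mathbb{F}_q^k$) is balanced if $b_1+\dots+b_k=0$; the system is balanced if every row of $A$ sums to $0$. A solution is generic if every balanced linear equation it satisfies (every $b\in\mathbb{F}_q^k$ with $\sum_j b_j=0$ and $\sum_j b_jx_j=0$) is a linear combination of the rows of $A$. The system is temperate if there exist constants $\beta,\gamma>0$ with $\gamma<q$ such that for every $n$, every $S\subseteq\mathbb{F}_q^n$ with $|S|\ge\beta\gamma^n$ contains a generic solution $(x_1,\dots,x_k)\in S^k$. Two indices $j,j'\in[k]$ are equivalent if the $j$-th and $j'$-th columns of $A$ are nonzero scalar multiples of one another; the equivalence classes are the column equivalence classes. A class sums to zero if the columns indexed by it add up to the zero vector. Type (RC): balanced with at most one column equivalence class of size $1$. Non-degenerate: rows of $A$ linearly independent and no zero column. Two systems are equivalent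 if each equation of one is a linear combination of the equations of the other. A system is reducible if it is equivalent to a system whose variables can be partitioned into two or more classes such that every equation only uses (has nonzero coefficients on) variables from one class; otherwise irreducible. *)

(* Defs.v *)
From HB Require Import structures.
From mathcomp Require Import all_boot all_order all_algebra all_field.
From mathcomp Require Import reals.
Set Implicit Arguments. Unset Strict Implicit. Unset Printing Implicit Defensive.
Import Order.TTheory GRing.Theory Num.Theory.
Local Open Scope ring_scope.

Section LinSys.
Variables (F : finFieldType) (m k : nat) (A : 'M[F]_(m, k)).

Definition is_solution n (x : 'I_k -> 'rV[F]_n) : Prop :=
  forall i : 'I_m, \sum_(j < k) A i j *: x j = 0.

Definition balanced_eq (b : 'rV[F]_k) : bool := \sum_(j < k) b 0 j == 0.

Definition balanced_sys : Prop := forall i : 'I_m, balanced_eq (row i A).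

Definition generic n (x : 'I_k -> 'rV[F]_n) : Prop :=
  forall b : 'rV[F]_k, balanced_eq b -> \sum_(j < k) b 0 j *: x j = 0 ->
    (b <= A)%MS.

Definition temperate (R : realType) : Prop :=
  exists beta gamma : R, 0 < beta /\ 0 < gamma /\ gamma < (#|F|)%:R /\
    forall (n : nat) (S : {set 'rV[F]_n}),
      beta * gamma ^+ n <= (#|S|)%:R ->
      exists x : 'I_k -> 'rV[F]_n,
        (forall j, x j \in S) /\ is_solution x /\ generic x.

Definition col_equiv (j j' : 'I_k) : bool :=
  [exists c : F, (c != 0) && (col j A == c *: col j' A)].

Definition col_class (j : 'I_k) : {set 'I_k} := [set j' | col_equiv j j'].

Definition col_classes : {set {set 'I_k}} := [set col_class j | j : 'I_k].

Definition class_sums_zero (C : {set 'I_k}) : bool :=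
  \sum_(j in C) col j A == 0.

Definition typeRC : Prop :=
  balanced_sys /\ (#|[set C in col_classes | #|C| == 1%N]| <= 1)%N.

Definition sys_nondegenerate : Prop :=
  row_free A /\ forall j : 'I_k, col j A != 0.

(* A is sys_reducible if some equivalent system (same row space, any number of
   equations) has its variables partitioned into >= 2 nonempty classes
   (given by a labelling f) such that every equation only uses variables
   from one class. *)
Definition sys_reducible : Prop :=
  exists (m' : nat) (A' : 'M[F]_(m', k)), (A' == A)%MS /\
    exists f : 'I_k -> 'I_k, (exists j1 j2, f j1 != f j2) /\
      forall (i : 'I_m') (j j' : 'I_k), A' i j != 0 -> A' i j' != 0 -> f j = f j'.

Definition sys_irreducible : Prop := ~ sys_reducible.

End LinSys.

(* Main.v *)
(** Say that a property of subsets of F_q^n is forced if, for some gamma < q, every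
    set of size at least beta gamma^n has it. Given c_1 + ... + c_r = 1 with all
    c_j <> 0, all but few points y of a large set S are of the form
    y = sum_j c_j x_j with x_j in S whose differences x_j - y satisfy, modulo any
    prescribed subspace of bounded dimension, only the relation c itself. By
    induction on r this reduces to two cases: y = c x1 + (1 - c) x2 (slice rank;
    passing to an independent set of a graph of bounded out-degree makes x1 - y
    avoid the subspace) and y + z = x1 + x2 (Cauchy-Schwarz count), the latter when
    all c_j are 1, so that splitting off one variable would leave weight 0.

    A system can then be collapsed along classes of weighted variables: it suffices
    to find the points that the classes represent. In case (i), after normalization,
    the system says that the m + 1 classes all represent the same point. In case
    (ii), splitting each class into one variable and the rest turns the system into
    B w = B z, which is solved generically by Cauchy-Schwarz. *)
Require Import Defs.
From HB Require Import structures.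
From mathcomp Require Import all_boot all_order all_algebra all_field.
From mathcomp Require Import reals boolp ring lra zify.
Set Implicit Arguments. Unset Strict Implicit. Unset Printing Implicit Defensive.
Import Order.TTheory GRing.Theory Num.Theory.
Local Open Scope ring_scope.

(** * Properties forced by size *)

(** [temperate A R] is convertible to an instance of this: having a generic solution is forced. *)
Definition forced (R : realType) (F : finFieldType)
    (P : forall n, {set 'rV[F]_n} -> Prop) : Prop :=
  exists beta gamma : R, 0 < beta /\ 0 < gamma /\ gamma < #|F|%:R /\
    forall n (T : {set 'rV[F]_n}), beta * gamma ^+ n <= #|T|%:R -> P n T.

Section Forced.
Variables (R : realType) (F : finFieldType).
Implicit Types P Q : forall n, {set 'rV[F]_n} -> Prop.

Lemma forced_imp P Q :
  (forall n T, P n T -> Q n T) -> forced R P -> forced R Q.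
Proof.
move=> PQ [b [g [b0 [g0 [gq H]]]]]; exists b, g; do 3!split=> //.
by move=> n T /H /PQ.
Qed.

(** A part [D] too small for [Q] leaves at least [b * max(g, g')^n] points, enough for [P]. With [D]
    the set of bad points, this says that all but few points are good. *)
Lemma forced_split P Q :
  forced R P -> forced R Q ->
  forced R (fun n S => forall D : {set 'rV[F]_n}, D \subset S ->
                         Q n D \/ P n (S :\: D)).
Proof.
move=> [b [g [b0 [g0 [gq HP]]]]] [b' [g' [b'0 [g'0 [g'q HQ]]]]].
exists (b + b'), (Num.max g g'); split; first exact: addr_gt0.
split; first by rewrite lt_max g0.
split; first by rewrite gt_max gq.
move=> n S hS D DS.
have [hD|hD] := leP (b' * g' ^+ n) #|D|%:R; first by left; apply: HQ.
right; apply: HP.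
have e : (#|S|%:R : R) = #|D|%:R + #|S :\: D|%:R.
  by rewrite -natrD -(cardsID D S) (setIidPr DS).
have h1 : b * g ^+ n <= b * Num.max g g' ^+ n.
  by rewrite ler_pM2l // lerXn2r ?nnegrE ?le_max ?lexx ?(ltW g0).
have h2 : b' * g' ^+ n <= b' * Num.max g g' ^+ n.
  by rewrite ler_pM2l // lerXn2r ?nnegrE ?le_max ?lexx ?orbT ?(ltW g'0) ?orbT.
move: hS; rewrite e mulrDl; lra.
Qed.

(** Counting arguments yield the base [q^(s/(s+1))]; the base [q - 1/(s+1)] is no smaller and avoids
    real roots. *)
Lemma forced_of_card_exp P (C s : nat) :
  (forall n (T : {set 'rV[F]_n}),
     (C * #|F| ^ (n * s) < #|T| ^ s.+1)%N -> P n T) -> forced R P.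
Proof.
move=> H; set q : R := #|F|%:R.
have q2 : 2 <= q by rewrite /q ler_nat card_finNzRing_gt1.
have s0 : 0 < (s.+1%:R : R) by rewrite ltr0n.
have [i [i0 i1 si]] : exists i : R, [/\ 0 < i, i <= 1 & s.+1%:R * i = 1].
  exists (s.+1%:R)^-1; rewrite invr_gt0 s0 invf_le1 // ler1n; split=> //.
  by rewrite mulfV // gt_eqF.
pose g := q - i.
exists C.+1%:R, g; split; first by rewrite ltr0n.
split; first by rewrite /g; lra.
split; first by rewrite /g -/q; lra.
(* Bernoulli: g^(s+1) >= q^(s+1) - q^s >= q^s *)
have hg : q ^+ s <= g ^+ s.+1.
  have bern j : q ^+ j.+1 - j.+1%:R * i * q ^+ j <= g ^+ j.+1.
    elim: j => [|j IH]; first by rewrite !expr1 expr0 mulr1 mul1r.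
    have g0 : 0 <= g by rewrite /g; lra.
    rewrite [g ^+ j.+2]exprS; apply: le_trans (ler_wpM2l g0 IH).
    rewrite /g -[j.+2%:R]natr1 !exprS.
    set Q := q ^+ j; set J := j.+1%:R.
    have -> : (q - i) * (q * Q - J * i * Q) =
      q * (q * Q) - (J + 1) * i * (q * Q) + J * i * i * Q by ring.
    rewrite lerDl !mulr_ge0 ?(ltW i0) // exprn_ge0 //; lra.
  apply: le_trans (bern s); rewrite si mul1r exprS.
  have : 0 <= q ^+ s by rewrite exprn_ge0 //; lra.
  nra.
move=> n T hT; apply: H.
rewrite -(ltr_nat R) natrM !natrX.
have hb : 0 <= C.+1%:R * g ^+ n.
  by rewrite mulr_ge0 // exprn_ge0 // /g; lra.
have h1 : (C.+1%:R * g ^+ n) ^+ s.+1 <= (#|T|%:R : R) ^+ s.+1.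
  by rewrite lerXn2r // nnegrE // ler0n.
apply: lt_le_trans h1.
have e : g ^+ n ^+ s.+1 = g ^+ s.+1 ^+ n by rewrite -!exprM mulnC.
rewrite exprMn e.
have -> : q ^+ (n * s) = q ^+ s ^+ n by rewrite mulnC exprM.
have hq : 0 < q ^+ s ^+ n by rewrite !exprn_gt0 //; lra.
have hgq : q ^+ s ^+ n <= g ^+ s.+1 ^+ n.
  by rewrite lerXn2r // ?nnegrE ?exprn_ge0 // /g; lra.
have hC : C%:R < (C.+1%:R : R) ^+ s.+1.
  rewrite -natrX ltr_nat expnS; apply: leq_pmulr.
  by rewrite expn_gt0.
apply: (@lt_le_trans _ _ (C.+1%:R ^+ s.+1 * q ^+ s ^+ n)).
  by rewrite ltr_pM2r.
by rewrite ler_pM2l // exprn_gt0 // ltr0n.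
Qed.

(** If no [y] worked for every [u], choosing a failing [u] for each [y] would give a function [U]
    that fails everywhere. A counting argument then has only one [u] per point to deal with. *)
Lemma forced_choice (X : nat -> Type)
    (Phi : forall n, {set 'rV[F]_n} -> 'rV[F]_n -> X n -> Prop) :
  (forall n, inhabited (X n)) ->
  forced R (fun n T => forall U : 'rV[F]_n -> X n,
              exists2 y, y \in T & Phi n T y (U y)) ->
  forced R (fun n T => exists2 y, y \in T & forall u, Phi n T y u).
Proof.
move=> inhX; apply: forced_imp => n T H; apply: contrapT => noy.
have /choice [U hU] : forall y, exists u, y \in T -> ~ Phi n T y u.
  move=> y; apply: contrapT => nou; apply: noy; exists y.
    by apply: contrapT => yT; apply: nou; have [u] := inhX n; exists u.
  by move=> u; apply: contrapT => nPhi; apply: nou; exists u.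
by have [y yT] := H U; apply: hU.
Qed.

(** Apply [forced_split] to the set [D] of points violating [Psi] relative to [S]: by monotonicity
    none of them satisfies [Psi] relative to [D]. So the complement has [P], while its points are
    represented within all of [S]. *)
Lemma forced_within P (Psi : forall n, {set 'rV[F]_n} -> 'rV[F]_n -> Prop) :
  (forall n (T T' : {set 'rV[F]_n}) y, T \subset T' -> Psi n T y -> Psi n T' y) ->
  forced R P -> forced R (fun n T => exists2 y, y \in T & Psi n T y) ->
  forced R (fun n S => exists T : {set 'rV[F]_n},
    [/\ T \subset S, P n T & forall y, y \in T -> Psi n S y]).
Proof.
move=> Psi_sub hP hPsi; apply: forced_imp (forced_split hP hPsi) => n S H.
pose D := [set y in S | `[< ~ Psi n S y >]].
have DS : D \subset S by apply/subsetP => y; rewrite inE => /andP [].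
have [[y yD Psiy]|PSD] := H D DS.
  move: (yD); rewrite inE => /andP [_ /asboolP []]; exact: Psi_sub Psiy.
exists (S :\: D); split=> //; first exact: subsetDl.
move=> y; rewrite !inE => /andP [h yS]; move: h; rewrite yS /= => /asboolPn.
exact: contrapT.
Qed.

Lemma forced_within_seq (I : eqType) (s : seq I) P
    (Psi : I -> forall n, {set 'rV[F]_n} -> 'rV[F]_n -> Prop) :
  (forall i n (T T' : {set 'rV[F]_n}) y,
     T \subset T' -> Psi i n T y -> Psi i n T' y) ->
  forced R P ->
  (forall i, i \in s -> forced R (fun n T => exists2 y, y \in T & Psi i n T y)) ->
  forced R (fun n S => exists T : {set 'rV[F]_n},
    [/\ T \subset S, P n T & forall y i, y \in T -> i \in s -> Psi i n S y]).
Proof.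
move=> Psi_sub hP; elim: s => [|i s IH] hPsi.
  by apply: forced_imp hP => n T PT; exists T; split.
have hs := IH (fun j js => hPsi j (mem_behead (s := i :: s) js)).
have := forced_within (Psi_sub i) hs (hPsi i (mem_head i s)).
apply: forced_imp => n S [T' [T'S [T [TT' PT hT]] hT']].
exists T; split=> //; first exact: subset_trans TT' T'S.
move=> y j yT /predU1P [->|js]; first by apply: hT'; apply: (subsetP TT').
by apply: Psi_sub (hT y j yT js).
Qed.
End Forced.

(** * The slice rank bound *)

Section SliceRank.
Variable F : finFieldType.
Local Notation Q := #|F|.-1.

Lemma card_predK : Q.+1 = #|F|.
Proof. by rewrite prednK // ltnW // card_finNzRing_gt1. Qed.

Lemma eq0_expf (u : F) : (u == 0)%:R = 1 - u ^+ Q.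
Proof.
have Q0 : (0 < Q)%N by rewrite -ltnS card_predK card_finNzRing_gt1.
have [->|u0] := eqVneq u 0; first by rewrite expr0n gtn_eqF // subr0.
apply/esym/eqP; rewrite subr_eq0 eq_sym; apply/eqP/(mulfI u0).
by rewrite -exprS card_predK expf_card mulr1.
Qed.

(** Fermat turns the indicator into [1 - (v 0 + v 1 + v 2)^Q], of total degree at most [Q]. *)
Lemma sum3_eq0_expansion :
  exists (E : finType) (w : E -> F) (d : 'I_3 -> E -> 'I_Q.+1),
    (forall e, \sum_s d s e <= Q)%N /\
    forall v : 'I_3 -> F,
      (\sum_s v s == 0)%:R = \sum_e w e * \prod_s v s ^+ d s e.
Proof.
(* The constant term is [inl tt]; a function [f] stands for the term of the multiplied-out power
   that takes [v (f t)] from factor [t]. Equal monomials are not merged. *)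
pose E : finType := (unit + {ffun 'I_Q -> 'I_3})%type.
pose deg s (e : E) : nat := if e is inr f then (\sum_t (f t == s))%N else 0%N.
have sumdeg e : (\sum_s deg s e <= Q)%N.
  case: e => [u|f] /=; first by rewrite big1.
  rewrite exchange_big /=; apply: (@leq_trans (\sum_(t < Q) 1)%N).
    apply: leq_sum => t _; rewrite (bigD1 (f t)) //= eqxx big1 // => s.
    by rewrite eq_sym => /negPf ->.
  by rewrite sum1_card card_ord.
have degP s e : (deg s e < Q.+1)%N.
  by rewrite ltnS; apply: leq_trans (sumdeg e); rewrite (bigD1 s) //= leq_addr.
exists E, (fun e => if e is inl _ then 1 else -1), (fun s e => Ordinal (degP s e)).
split=> [//|v]; rewrite eq0_expf big_sumType /=.
rewrite (bigD1 tt) //= [X in _ + X + _]big1 => [|[]//].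
rewrite addr0 mul1r [X in _ = X + _]big1 // -mulr_sumr mulN1r; congr (_ - _).
rewrite -[in LHS](card_ord Q) -prodr_const bigA_distr_bigA /=.
apply: eq_bigr => f _.
transitivity (\prod_(t < Q) \prod_(s < 3) v s ^+ (f t == s)).
  apply: eq_bigr => t _; rewrite (bigD1 (f t)) //= eqxx big1 ?mulr1 // => s.
  by rewrite eq_sym => /negPf ->.
by rewrite exchange_big /=; apply: eq_bigr => s _; rewrite prodrXr.
Qed.

Definition monomial n (f : {ffun 'I_n -> 'I_Q.+1}) (x : 'rV[F]_n) : F :=
  \prod_t x 0 t ^+ f t.

(** The indicator of a zero vector is the product of those of its coordinates; a term of the
    expanded product chooses a one-coordinate term for each coordinate. *)
Lemma lincomb3_eq0_expansion n (a : 'I_3 -> F) :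
  exists (E : finType) (w : E -> F) (d : 'I_3 -> E -> {ffun 'I_n -> 'I_Q.+1}),
    (forall e, \sum_s \sum_t d s e t <= n * Q)%N /\
    forall x : 'I_3 -> 'rV[F]_n,
      (\sum_s a s *: x s == 0)%:R = \sum_e w e * \prod_s monomial (d s e) (x s).
Proof.
have [E [w [d [degd dE]]]] := sum3_eq0_expansion.
exists {ffun 'I_n -> E},
  (fun e : {ffun 'I_n -> E} => \prod_t (w (e t) * \prod_s a s ^+ d s (e t))),
  (fun s (e : {ffun 'I_n -> E}) => [ffun t => d s (e t)]); split=> [e|x].
  rewrite exchange_big /=; apply: (@leq_trans (\sum_(t < n) Q)%N).
    apply: leq_sum => t _; under eq_bigr do rewrite ffunE; exact: degd.
  by rewrite sum_nat_const card_ord.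
transitivity (\prod_t (\sum_s a s * x s 0 t == 0)%:R : F).
  have [s0|sn0] := eqVneq (\sum_s a s *: x s) 0.
    rewrite big1 // => t _; move/rowP/(_ t): s0; rewrite summxE mxE.
    by under eq_bigr do rewrite mxE; move=> ->; rewrite eqxx.
  have [t tn0] : exists t, \sum_s a s * x s 0 t != 0.
    apply/existsP; apply: contra_neqT sn0 => /existsPn h.
    apply/rowP => t; rewrite summxE mxE; move: (h t); rewrite negbK => /eqP.
    by under [X in _ -> X = _]eq_bigr do rewrite mxE.
  by rewrite (bigD1 t) //= (negPf tn0) mul0r.
under eq_bigr do rewrite dE.
rewrite bigA_distr_bigA /=; apply: eq_bigr => e _.
rewrite /monomial exchange_big -big_split /=; apply: eq_bigr => t _.
rewrite -mulrA; congr (_ * _); rewrite -big_split /=.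
by apply: eq_bigr => s _; rewrite ffunE exprMn.
Qed.

(* A row-free matrix with r rows has r independent columns, so some vector of its
   row space equals 1 at those r places. *)
Lemma ker_support (N M : nat) (H : 'M[F]_(N, M)) :
  exists h : 'rV_N, h *m H = 0 /\ (N - M <= #|[set r | h 0%R r != 0%R]|)%N.
Proof.
set K := row_base (kermx H).
have Kf : row_full K^T by rewrite /row_full mxrank_tr; apply: row_base_free.
pose f := fullrankfun Kf.
pose h : 'rV_N := const_mx 1 *m invmx (rowsub f K^T)^T *m K.
exists h; split.
  have /eqP KH : K *m H == 0 by rewrite -sub_kermx eq_row_base.
  by rewrite /h -(mulmxA _ K) KH mulmx0.
have hf r : h 0 (f r) = 1.
  have : colsub f h = const_mx 1.
    rewrite /h -mulmx_colsub.
    have -> : colsub f K = (rowsub f K^T)^T by apply/matrixP=> i j; rewrite !mxE.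
    by rewrite mulmxKV // unitmx_tr fullrowsub_unit.
  by move/matrixP/(_ 0 r); rewrite !mxE.
apply: (@leq_trans (\rank (kermx H))).
  by rewrite mxrank_ker leq_sub2l // rank_leq_col.
rewrite -[X in (X <= _)%N]card_ord -(card_imset _ (@fullrankfun_inj _ _ _ _ Kf)).
by apply/subset_leq_card/subsetP => _ /imsetP [r _ ->]; rewrite inE hf oner_neq0.
Qed.

Lemma support_le_rank_diag N (h : 'rV[F]_N) :
  (#|[set r | h 0%R r != 0%R]| <= \rank (diag_mx h))%N.
Proof.
set S := [set r | _].
pose f (i : 'I_#|S|) : 'I_N := enum_val i.
pose D : 'M_#|S| := diag_mx (\row_i h 0 (f i)).
have -> : #|S| = \rank D.
  apply/esym/mxrank_unit; rewrite unitmxE det_diag unitfE; apply/prodf_neq0 => i _.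
  by rewrite mxE; have := enum_valP i; rewrite inE.
have -> : D = (rowsub f (rowsub f (diag_mx h))^T)^T.
  apply/matrixP=> i j; rewrite !mxE (inj_eq enum_val_inj).
  by case: eqVneq => [->|].
rewrite mxrank_tr rowsubE; apply: leq_trans (mxrankM_maxr _ _) _.
by rewrite mxrank_tr rowsubE; apply: mxrankM_maxr.
Qed.

Definition low_monomials n : {set {ffun 'I_n -> 'I_Q.+1}} :=
  [set f : {ffun 'I_n -> 'I_Q.+1} | (3 * (\sum_t f t) <= n * Q)%N].

(** Slice rank argument. On [T] the indicator of the equation is the diagonal tensor. Contracting
    its first variable with a vector [h] orthogonal to all [M] low monomials gives [diag_mx h], of
    rank at least [|T| - M]. Every term is low in some variable; those low in the first vanish, and
    the others form a matrix of rank at most [2M]. *)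
Lemma card_three_term_free_le n (a : 'I_3 -> F) (T : {set 'rV[F]_n}) :
  \sum_s a s = 0 ->
  (forall x : 'I_3 -> 'rV_n, (forall s, x s \in T) -> \sum_s a s *: x s = 0 ->
     forall s s', x s = x s') ->
  (#|T| <= 3 * #|low_monomials n|)%N.
Proof.
move=> a0 Tfree; have [E [w [d [degd dE]]]] := lincomb3_eq0_expansion n a.
set M := #|low_monomials n|; set N := #|T|.
pose tt (r : 'I_N) : 'rV_n := enum_val r.
pose H : 'M[F]_(N, M) := \matrix_(r, f) monomial (enum_val f) (tt r).
have [h [hH hsup]] := ker_support H.
suff : (\rank (diag_mx h) <= M + M)%N.
  by move/(leq_trans (support_le_rank_diag h))/(leq_trans hsup); lia.
pose low (s : 'I_3) e := d s e \in low_monomials n.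
have lowP e : [|| low 0 e, low 1 e | low 2 e].
  have := degd e; rewrite !big_ord_recl big_ord0 /= addn0 /low !inE.
  have -> : lift 0 0 = 1 :> 'I_3 by apply/val_inj.
  have -> : lift 0 (lift 0 0) = 2 :> 'I_3 by apply/val_inj.
  move=> le3; have {le3} : (\sum_t d 0%R e t + (\sum_t d 1%R e t + \sum_t d 2%R e t) <= n * Q)%N by [].
  lia.
pose c e := w e * \sum_r h 0 r * monomial (d 0 e) (tt r).
have c0 e : low 0 e -> c e = 0.
  move=> l0; rewrite /c; suff -> : \sum_r h 0 r * monomial (d 0 e) (tt r) = 0.
    by rewrite mulr0.
  have /rowP/(_ (enum_rank_in (l0 : d 0 e \in low_monomials n) (d 0 e))) := hH.
  rewrite !mxE => hh; rewrite -[RHS]hh; apply: eq_bigr => r _.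
  by rewrite mxE enum_rankK_in.
pose X : 'M_(N, M) := \matrix_(y, f) monomial (enum_val f) (tt y).
pose Y1 : 'M_(M, N) := \matrix_(f, z)
  \sum_(e | low 1 e && (d 1 e == enum_val f)) c e * monomial (d 2 e) (tt z).
pose Y2 : 'M_(N, M) := \matrix_(y, f)
  \sum_(e | ~~ low 1 e && low 2 e && (d 2 e == enum_val f))
     c e * monomial (d 1 e) (tt y).
(* Collecting the terms by their low monomial makes the sum factor through an [M]-dimensional
   space. *)
have regroup (P : pred E) s (G : E -> F) z :
    (forall e, P e -> low s e) ->
    \sum_(e | P e) G e * monomial (d s e) (tt z) =
    \sum_(f < M) (\sum_(e | P e && (d s e == enum_val f)) G e) * X z f.
  move=> Plow; have [/eqP M0|] := posnP M.
    rewrite big1 => [|e /Plow]; last first.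
      by rewrite /low; move: M0; rewrite cards_eq0 => /eqP ->; rewrite inE.
    by rewrite big1 // => f _; have /leq_trans/(_ (eq_leq (eqP M0))) := ltn_ord f.
  move=> /card_gt0P [g0 lg0].
  rewrite (partition_big (fun e => enum_rank_in lg0 (d s e)) xpredT) //=.
  apply: eq_bigr => f _; rewrite mulr_suml !mxE.
  have PE e : P e && (enum_rank_in lg0 (d s e) == f) = P e && (d s e == enum_val f).
    case Pe: (P e) => //=; have := Plow _ Pe; rewrite /low => le.
    apply/eqP/eqP => [<-|->]; first by rewrite enum_rankK_in.
    by rewrite enum_valK_in.
  rewrite (eq_bigl _ _ PE); apply: eq_bigr => e /andP [_ /eqP ->].
  by [].
pose xs r y z (s : 'I_3) := tt (tnth [tuple r; y; z] s).
have indE r y z : (\sum_s a s *: xs r y z s == 0) = (r == y) && (y == z).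
  apply/eqP/andP => [h0|[/eqP -> /eqP ->]].
    have eqs := Tfree _ (fun s => enum_valP _) h0.
    by split; apply/eqP/enum_val_inj; [apply: (eqs 0 1)|apply: (eqs 1 2)].
  rewrite (eq_bigr (fun s => a s *: tt z)) -?scaler_suml ?a0 ?scale0r //.
  move=> s _; congr (_ *: tt _); rewrite (tnth_nth z) /=.
  by case: s => [[|[|[|]]]].
(* [X *m Y1] gathers the terms low in the second variable, [Y2 *m X^T] those low in the third but
   not in the second. *)
have -> : diag_mx h = X *m Y1 + Y2 *m X^T.
  apply/matrixP => y z; rewrite !mxE.
  transitivity (\sum_e c e * monomial (d 1 e) (tt y) * monomial (d 2 e) (tt z)).
    transitivity (\sum_r h 0 r * (\sum_s a s *: xs r y z s == 0)%:R).
      under eq_bigr do rewrite indE.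
      rewrite (bigD1 y) //= big1 ?addr0 => [|r /negPf ->]; last by rewrite mulr0.
      by rewrite eqxx mulr_natr.
    under eq_bigr do rewrite dE mulr_sumr.
    rewrite exchange_big /=; apply: eq_bigr => e _.
    rewrite /c mulr_sumr !mulr_suml; apply: eq_bigr => r _.
    rewrite !big_ord_recl big_ord0 mulr1.
    have -> : lift 0 0 = 1 :> 'I_3 by apply/val_inj.
    have -> : lift 0 (lift 0 0) = 2 :> 'I_3 by apply/val_inj.
    rewrite /xs /=; ring.
  rewrite (bigID (low 1)) /=; congr (_ + _).
    under eq_bigr do rewrite mulrAC.
    rewrite regroup //; apply: eq_bigr => f _.
    by rewrite !mxE mulrC.
  rewrite (bigID (low 2)) /= [X in _ + X]big1 ?addr0 => [|e /andP [l1 l2]].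
    rewrite (regroup _ 2) => [|e /andP []//]; apply: eq_bigr => f _.
    by rewrite !mxE.
  rewrite c0 ?mul0r //; have := lowP e.
  by rewrite (negPf l1) (negPf l2) !orbF.
apply: leq_trans (mxrank_add _ _) _; apply: leq_add; exact: mulmx_max_rank.
Qed.
End SliceRank.

(** * Three-term equations *)

Lemma exprB1_le (R : realType) (e : R) j :
  0 <= e <= 1 -> (1 - e) ^+ j <= 1 - j%:R * e + (j%:R * e) ^+ 2.
Proof.
move=> /andP [e0 e1]; elim: j => [|j IH]; first by rewrite expr0; lra.
have u0 : 0 <= 1 - e by lra.
rewrite exprS; apply: le_trans (ler_wpM2l u0 IH) _; rewrite -natr1.
have J : 0 <= (j%:R : R) by rewrite ler0n.
have : 0 <= j%:R * e * e + j%:R * j%:R * e * e * e + e * e.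
  by rewrite !addr_ge0 // !mulr_ge0.
rewrite !expr2; nra.
Qed.

Lemma exprB1_ge (R : realType) (e : R) j :
  0 <= e <= 1 -> 1 - j%:R * e <= (1 - e) ^+ j.
Proof.
move=> /andP [e0 e1]; elim: j => [|j IH]; first by rewrite expr0; lra.
have u0 : 0 <= 1 - e by lra.
rewrite exprS; apply: le_trans (ler_wpM2l u0 IH); rewrite -natr1.
have J : 0 <= (j%:R : R) by rewrite ler0n.
have : 0 <= j%:R * e * e by rewrite !mulr_ge0.
nra.
Qed.

(** Chernoff bound: with weight [u^(3 * degree)] all exponent vectors together weigh [S^n], and each
    low one at least [u^(n * Q)]. To first order in [e], [S] is [(Q+1) * (1 - 3/2 * Q * e)], as the
    mean exponent is [Q/2], while [u^Q] is [1 - Q * e]; so [S / u^Q < q] for small [e]. *)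
Lemma card_low_monomials_le (R : realType) (F : finFieldType) :
  exists g : R, [/\ 0 < g, g < #|F|%:R &
    forall n, #|low_monomials F n|%:R <= g ^+ n].
Proof.
set Q := #|F|.-1; have QS : Q.+1 = #|F| := card_predK F.
have Q0 : (0 < Q)%N by rewrite -ltnS card_predK card_finNzRing_gt1.
have Q1 : 1 <= (Q%:R : R) by rewrite ler1n.
(* With [t = Q * e], the first-order gain is [t / 2] and the second-order loss [9 * t^2]; [t = 1/36]
   is half of the critical value 1/18. *)
have [e [e0 e1 eQ]] : exists e : R, [/\ 0 < e, e <= 1 & Q%:R * e = 36^-1].
  have Qp : 0 < (Q%:R : R) by rewrite ltr0n.
  exists (36^-1 / Q%:R); split; first by rewrite divr_gt0 // invr_gt0 ltr0n.
    by rewrite ler_pdivrMr //; lra.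
  by rewrite mulrC divfK // gt_eqF.
have e01 : 0 <= e <= 1 by rewrite e1 ltW.
set u := 1 - e.
have u0 : 0 < u by have := ler_peMl (ltW e0) Q1; rewrite eQ /u; lra.
have u1 : u <= 1 by rewrite /u; lra.
pose S : R := \sum_(i < Q.+1) u ^+ (3 * i).
have S0 : 0 < S.
  rewrite /S (bigD1 ord0) //= muln0 expr0 ltr_pwDl // sumr_ge0 // => i _.
  by rewrite exprn_ge0 // ltW.
have uQ : 0 < u ^+ Q by rewrite exprn_gt0.
exists (S / u ^+ Q); split; first by rewrite divr_gt0.
- rewrite ltr_pdivrMr // -card_predK.
  apply: (@lt_le_trans _ _ (Q.+1%:R * (1 - Q%:R * e))); last first.
    by rewrite ler_pM2l ?ltr0n // exprB1_ge.
  have sumi : \sum_(i < Q.+1) (i%:R : R) = Q.+1%:R * Q%:R / 2.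
    elim: (Q) => [|m IH]; first by rewrite big_ord_recl big_ord0 mulr0 mul0r addr0.
    by rewrite big_ord_recr /= IH -[m.+2%:R]natr1 -[m.+1%:R]natr1; field.
  have : S <= \sum_(i < Q.+1) (1 - 3 * e * i%:R + (3 * (Q%:R * e)) ^+ 2).
    apply: ler_sum => i _; apply: le_trans (exprB1_le _ e01) _.
    have iQ : (i%:R : R) <= Q%:R by rewrite ler_nat -ltnS.
    have i0 : 0 <= (i%:R : R) by rewrite ler0n.
    rewrite natrM; apply: lerD; first by lra.
    rewrite lerXn2r ?nnegrE ?mulr_ge0 ?(ltW e0) ?ler0n //.
    by rewrite -mulrA ler_pM2l // ler_pM2r.
  rewrite !big_split /= sumrN -mulr_sumr sumi !sumr_const !card_ord -(mulr_natr (_ ^+ 2)).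
  move/le_lt_trans; apply; rewrite eQ.
  have -> : 3 * e * (Q.+1%:R * Q%:R / 2) = 3 / 2 * Q.+1%:R * (Q%:R * e) by ring.
  rewrite eQ; have : 0 < (Q.+1%:R : R) by rewrite ltr0n.
  lra.
- move=> n; rewrite expr_div_n ler_pdivlMr ?exprn_gt0 // -exprM mulnC.
  have -> : S ^+ n = \sum_(f : {ffun 'I_n -> 'I_Q.+1}) u ^+ (3 * \sum_t f t).
    rewrite -[in LHS](card_ord n) -prodr_const bigA_distr_bigA /=.
    apply: eq_bigr => f _; rewrite big_distrr /= -prodrXr.
    by apply: eq_bigl.
  rewrite [leRHS](bigID (mem (low_monomials F n))) /=.
  apply: le_trans (_ : \sum_(f in low_monomials F n) u ^+ (n * Q) <= _).
    by rewrite sumr_const -[leRHS]mulr_natl.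
  rewrite -[leLHS]addr0; apply: lerD; last first.
    by rewrite sumr_ge0 // => f _; rewrite exprn_ge0 // ltW.
  apply: ler_sum => f; rewrite inE => lf.
  by apply: ler_wiXn2l => //; rewrite ltW.
Qed.

(** In-degree plus out-degree is at most [2D] on average, hence at some vertex [v]. Keep [v] for
    [I], delete it and its neighbours, at most [2D + 1] vertices, and recurse. *)
Lemma bounded_outdegree_independent (V : finType) (r : rel V) (D : nat)
    (T : {set V}) :
  (forall x, x \in T -> (#|[set y in T | r x y]| <= D)%N) ->
  exists I : {set V}, [/\ I \subset T, (#|T| <= (2 * D).+1 * #|I|)%N &
    forall x y, x \in I -> y \in I -> x != y -> ~~ r x y].
Proof.
have [m] := ubnP #|T|; elim: m T => // m IH T Tm degT.
have [->|[v0 v0T]] := set_0Vmem T.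
  by exists set0; rewrite cards0 sub0set; split=> // x y; rewrite inE.
have [v vT degv] : exists2 v, v \in T &
    (#|[set y in T | r v y]| + #|[set y in T | r y v]| <= 2 * D)%N.
  apply/exists_inP; apply: contraT => /exists_inPn /= h.
  have : (#|T| * (2 * D).+1 <=
    \sum_(v in T) (#|[set y in T | r v y]| + #|[set y in T | r y v]|))%N.
    by rewrite -sum_nat_const; apply: leq_sum => v /h; rewrite -ltnNge.
  have incard : (\sum_(v in T) #|[set y in T | r y v]| =
                 \sum_(v in T) #|[set y in T | r v y]|)%N.
    under eq_bigr do rewrite -sum1_card (eq_bigl _ _ (fun y => in_set _ y)) big_mkcondr.
    rewrite exchange_big /=; apply: eq_bigr => v _.
    by rewrite -big_mkcondr -sum1_card; apply: eq_bigl => y; rewrite inE.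
  have degle : (\sum_(v in T) #|[set y in T | r v y]| <= #|T| * D)%N.
    by rewrite -sum_nat_const; apply: leq_sum.
  have T0 : (0 < #|T|)%N by apply/card_gt0P; exists v0.
  rewrite big_split /= incard; nia.
pose B := v |: ([set y in T | r v y] :|: [set y in T | r y v]).
have BT : B \subset T.
  by apply/subsetP => y; rewrite !inE => /or3P [/eqP ->|/andP []|/andP []].
have Bc : (#|B| <= (2 * D).+1)%N.
  apply: leq_trans (leq_card_setU _ _) _; rewrite cards1 ltnS.
  exact: leq_trans (leq_card_setU _ _) degv.
have cT : #|T| = (#|B| + #|T :\: B|)%N by rewrite -(cardsID B T) (setIidPr BT).
have B0 : (0 < #|B|)%N by apply/card_gt0P; exists v; rewrite !inE eqxx.
have [||I [IT cI indI]] := IH (T :\: B).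
- by move: Tm; rewrite cT; lia.
- move=> x /setDP [xT _]; apply: leq_trans (degT x xT); apply/subset_leq_card.
  by apply/subsetP => y; rewrite !inE => /andP [/andP [_ ->] ->].
have vI : v \notin I by apply/negP => /(subsetP IT); rewrite !inE eqxx.
have IP y : y \in I -> ~~ r v y /\ ~~ r y v.
  move=> /(subsetP IT); rewrite !inE !negb_or => /andP [/and3P [_ h1 h2] yT].
  by move: h1 h2; rewrite yT.
exists (v |: I); split.
- rewrite subUset sub1set vT; apply: subset_trans IT _; exact: subsetDl.
- by rewrite cardsU1 vI cT mulnDr muln1; apply: leq_add.
move=> x y; rewrite !inE => /predU1P [->|xI] /predU1P [->|yI]; rewrite ?eqxx //.
- by have [] := IP _ yI.
- by have [] := IP _ xI.
- exact: indI.
Qed.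

Lemma card_submx_le (F : finFieldType) K n (U : 'M[F]_(K, n)) (y : 'rV_n) :
  (#|[set x | ((x - y)%R <= U)%MS]| <= #|F| ^ K)%N.
Proof.
rewrite -[K in (_ ^ K)%N]mul1n -(card_mx F 1 K) -cardsT.
apply: leq_trans (leq_imset_card (fun a => a *m U + y) _).
apply/subset_leq_card/subsetP => x; rewrite inE => /submxP [a xy].
by apply/imsetP; exists a; rewrite // -xy subrK.
Qed.

(** If every representation of every [y] had [x1 - y] in a subspace [U y], consider the graph
    joining [y] to the points of [y + U y], of out-degree at most [q^K]. A large independent set in
    it has only constant solutions, against the slice rank bound. *)
Lemma three_term_forced (R : realType) (F : finFieldType) (c : F) (K : nat) :
  c != 0 -> c != 1 ->
  forced R (fun n (T : {set 'rV[F]_n}) => exists2 y, y \in T &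
    forall U : 'M_(K, n), exists x1 x2, [/\ x1 \in T, x2 \in T,
      y = c *: x1 + (1 - c) *: x2 & ~~ (x1 - y <= U)%MS]).
Proof.
move=> c0 c1; have [g [g0 gq hg]] := card_low_monomials_le R F.
set D := (#|F| ^ K)%N.
apply: (forced_choice (X := fun n => 'M[F]_(K, n))
  (Phi := fun n T y U => exists x1 x2, [/\ x1 \in T, x2 \in T,
     y = c *: x1 + (1 - c) *: x2 & ~~ (x1 - y <= U)%MS])) => [n|].
  by constructor; exact: 0.
exists (3 * (2 * D).+1)%N.+1%:R, g; rewrite ltr0n; do 3!split=> //.
move=> n T hT U; apply: contrapT => noy.
have {noy} hU y x1 x2 : y \in T -> x1 \in T -> x2 \in T ->
    y = c *: x1 + (1 - c) *: x2 -> (x1 - y <= U y)%MS.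
  move=> yT h1 h2 e; apply: contrapT => /negP h; apply: noy.
  by exists y => //; exists x1, x2.
have [|I [IT cI indI]] :=
  @bounded_outdegree_independent _ (fun x y => (y - x <= U x)%MS) D T.
  move=> x _; apply: leq_trans (card_submx_le (U x) x); apply: subset_leq_card.
  by apply/subsetP => y; rewrite !inE => /andP [].
pose a (s : 'I_3) := tnth [tuple 1; - c; c - 1] s.
have hI : (#|I| <= 3 * #|low_monomials F n|)%N; first apply: (@card_three_term_free_le _ n a).
- by rewrite !big_ord_recl big_ord0 /a !(tnth_nth 0) /= addr0 addKr subrr.
- move=> x xI; rewrite !big_ord_recl big_ord0 /a !(tnth_nth 0) /= addr0.
  have -> : lift 0 0 = 1 :> 'I_3 by apply/val_inj.
  have -> : lift 0 (lift 0 0) = 2 :> 'I_3 by apply/val_inj.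
  rewrite scale1r => xe.
  have e0 : x 0 = c *: x 1 + (1 - c) *: x 2.
    by apply/eqP; rewrite -subr_eq0 opprD -!scaleNr opprB xe.
  (* By [hU] there is an edge from [x 0] to [x 1], so independence makes them equal. *)
  have x10 : x 1 = x 0.
    apply/eqP; rewrite eq_sym; apply: contraT => /(indI _ _ (xI 0) (xI 1)).
    by rewrite (hU (x 0) _ (x 2)) // (subsetP IT).
  have x20 : x 2 = x 0.
    have : (1 - c) *: (x 2 - x 0) = 0.
      have -> : (1 - c) *: (x 2 - x 0) = c *: x 0 + (1 - c) *: x 2 - x 0.
        by rewrite scalerBr [(1 - c) *: x 0]scalerBl scale1r opprB addrCA addrA.
      by rewrite -{1}x10 -e0 subrr.
    move/eqP; rewrite scaler_eq0 subr_eq0 eq_sym (negPf c1) /=.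
    by rewrite subr_eq0 => /eqP.
  have xall s : x s = x 0.
    case: s => [[|[|[|//]]] hs]; [congr x| rewrite -[RHS]x10; congr x
      | rewrite -[RHS]x20; congr x]; exact: val_inj.
  by move=> s s'; rewrite !xall.
have gn : 0 < g ^+ n by rewrite exprn_gt0.
have := leq_trans cI (leq_mul (leqnn _) hI).
rewrite -(ler_nat R) mulnA natrM => /(le_trans hT).
move/le_trans/(_ (ler_wpM2l (ler0n _ _) (hg n))).
by rewrite ler_pM2r // ler_nat mulnC ltnn.
Qed.

(** * Affine representations with independent differences *)

Lemma card_collisions_ge (X Y : finType) (f : X -> Y) (A : {set X}) :
  (#|A| ^ 2 <= #|Y| * #|[set p in setX A A | f p.1 == f p.2]|)%N.
Proof.
pose r y := #|[set x in A | f x == y]|.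
have sumr : (\sum_y r y = #|A|)%N.
  rewrite -[RHS]sum1_card (partition_big f xpredT) //=; apply: eq_bigr => y _.
  by rewrite /r -sum1_card; apply: eq_bigl => x; rewrite inE.
have sumr2 : (\sum_y r y ^ 2 = #|[set p in setX A A | f p.1 == f p.2]|)%N.
  rewrite -[RHS]sum1_card (partition_big (fun p : X * X => f p.1) xpredT) //=.
  apply: eq_bigr => y _; rewrite sum1_card expnS expn1 /r -cardsX.
  apply: eq_card => -[x x']; rewrite [RHS]unfold_in !inE /=.
  case: (x \in A); case: (x' \in A); rewrite ?andbF //=.
  by case: eqP => [->|]; rewrite ?andbF // andbT eq_sym.
rewrite -sumr -sumr2 -(leq_pmul2l (isT : 0 < 2)%N).
have -> : (2 * (\sum_y r y) ^ 2 = \sum_y \sum_(y' : Y) 2 * (r y * r y'))%N.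
  rewrite expnS expn1 big_distrlr /= big_distrr /=; apply: eq_bigr => y _.
  by rewrite big_distrr.
have -> : (2 * (#|Y| * \sum_y r y ^ 2) = \sum_y \sum_(y' : Y) (r y ^ 2 + r y' ^ 2))%N.
  under [RHS]eq_bigr do rewrite big_split /= sum_nat_const.
  by rewrite big_split /= sum_nat_const -big_distrr /= cardT -cardE; lia.
by apply: leq_sum => y _; apply: leq_sum => y' _; apply: nat_Cauchy.
Qed.

(** At least [|T|^4 / q^n] quadruples satisfy [x1 + x2 = y + z]. A bad one has a nontrivial relation
    modulo [U y], so [y], the relation and one of [x1], [x2] determine it: at most
    [2 * q^2 * q^K * q^(2n)] are bad. *)
Lemma parallelogram_forced (R : realType) (F : finFieldType) (K : nat) :
  forced R (fun n (T : {set 'rV[F]_n}) => exists2 y, y \in T &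
    forall U : 'M_(K, n), exists x1 x2 z,
      [/\ x1 \in T, x2 \in T, z \in T, x1 + x2 = y + z &
        forall b1 b2, ((b1 *: (x1 - y) + b2 *: (x2 - y))%R <= U)%MS ->
          b1 = 0 /\ b2 = 0]).
Proof.
apply: (forced_choice (X := fun n => 'M[F]_(K, n))
  (Phi := fun n T y U => exists x1 x2 z,
      [/\ x1 \in T, x2 \in T, z \in T, x1 + x2 = y + z &
        forall b1 b2, ((b1 *: (x1 - y) + b2 *: (x2 - y))%R <= U)%MS ->
          b1 = 0 /\ b2 = 0])) => [n|]; first by constructor; exact: 0.
apply: (@forced_of_card_exp _ _ _ (2 * (#|F| ^ 2 * #|F| ^ K)) 3).
move=> n T hT U; apply: contrapT => noy.
have bad y z x1 x2 : y \in T -> z \in T -> x1 \in T -> x2 \in T ->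
    x1 + x2 = y + z -> exists (b : F * F) (a : 'rV_K), b != (0, 0) /\
      b.1 *: (x1 - y) + b.2 *: (x2 - y) = a *m U y.
  move=> yT zT x1T x2T e; apply: contrapT => nob; apply: noy; exists y => //.
  exists x1, x2, z; split=> // b1 b2 /submxP [a ha]; apply: contrapT => nb.
  apply: nob; exists (b1, b2), a; split=> //.
  by apply/eqP => -[b10 b20]; apply: nb.
(* Solves the relation for the point whose coefficient [b] is nonzero, given the other point [w]; in
   [G] the flag [s] says that this point is [x1]. *)
pose other (b b' : F) a (y w : 'rV_n) := b^-1 *: (a *m U y - b' *: (w - y)) + y.
pose G (t : bool * (F * F) * 'rV[F]_K * 'rV[F]_n * 'rV[F]_n) :=
  let: (s, b, a, y, w) := t in
  let: (x1, x2) := if s then (other b.1 b.2 a y w, w)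
                   else (w, other b.2 b.1 a y w) in
  ((x1, x2), (y, x1 + x2 - y)).
have otherP b b' a y x w : b != 0 -> b *: (x - y) + b' *: (w - y) = a *m U y ->
    other b b' a y w = x.
  move=> b0 e; rewrite /other -e addrK scalerA mulVf // scale1r subrK //.
have := card_collisions_ge (fun p : 'rV[F]_n * 'rV[F]_n => p.1 + p.2) (setX T T).
rewrite cardsX card_mx mul1n; set P := [set p in _ | _] => hP.
have : (#|P| <= 2 * (#|F| ^ 2 * #|F| ^ K) * #|F| ^ n * #|F| ^ n)%N.
  have -> : (2 * (#|F| ^ 2 * #|F| ^ K) * #|F| ^ n * #|F| ^ n =
     #|{: bool * (F * F) * 'rV[F]_K * 'rV[F]_n * 'rV[F]_n}|)%N.
    by rewrite !card_prod card_bool !card_mx !mul1n mulnA.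
  rewrite -cardsT; apply: leq_trans (leq_imset_card G _).
  apply/subset_leq_card/subsetP => -[[x1 x2] [y z]]; rewrite !inE /=.
  move=> /andP [/andP [/andP [x1T x2T] /andP [yT zT]] /eqP e].
  have [b [a [b0 be]]] := bad y z x1 x2 yT zT x1T x2T e.
  have ze : z = x1 + x2 - y by rewrite e addrC addKr.
  apply/imsetP; have [b1z|b1n] := eqVneq b.1 0.
    exists (false, b, a, y, x1); rewrite ?inE //= (otherP _ _ _ _ x2) ?ze //.
      by apply: contra_neq b0 => b2z; rewrite [b]surjective_pairing b1z b2z.
    by rewrite addrC.
  by exists (true, b, a, y, x2); rewrite ?inE //= (otherP _ _ _ _ x1) ?ze.
move=> /(leq_mul (leqnn (#|F| ^ n)%N)) /(leq_trans hP).
rewrite leqNgt => /negP; apply; apply: leq_trans (_ : #|T| ^ 4 <= _)%N.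
  apply: leq_trans hT; rewrite ltnS leq_eqVlt; apply/orP; left; apply/eqP.
  by rewrite (_ : n * 3 = n + (n + n))%N ?expnD; lia.
by rewrite mulnn -expnM.
Qed.

(* K bounds the dimension of the subspace, here the row space of U. *)
Definition spread (I : finType) (F : finFieldType) (J : {set I}) (c : I -> F) K n
    (T : {set 'rV[F]_n}) (y : 'rV[F]_n) : Prop :=
  forall U : 'M_(K, n), exists x : I -> 'rV[F]_n,
    [/\ forall j, j \in J -> x j \in T, \sum_(j in J) c j *: x j = y &
      forall b : I -> F, ((\sum_(j in J) b j *: (x j - y))%R <= U)%MS ->
        exists lam, forall j, j \in J -> b j = lam * c j].

Lemma spread_sub (I : finType) (F : finFieldType) (J : {set I}) (c : I -> F) K n
    (T T' : {set 'rV[F]_n}) y :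
  T \subset T' -> spread J c K T y -> spread J c K T' y.
Proof.
move=> TT' h U; have [x [xT xy xU]] := h U; exists x; split=> // j /xT.
exact: (subsetP TT').
Qed.

Lemma sub_col_mx_add (F : fieldType) m1 m2 n (A : 'M[F]_(m1, n)) (B : 'M_(m2, n))
    (u v : 'rV_n) :
  (u <= A)%MS -> ((u + v)%R <= B)%MS -> (v <= col_mx A B)%MS.
Proof.
move=> uA uvB; have -> : v = (u + v) - u by rewrite addrC addKr.
rewrite -addsmxE addmx_sub //; first exact: submx_trans uvB (addsmxSr _ _).
by rewrite eqmx_opp; apply: submx_trans uA (addsmxSl _ _).
Qed.

Lemma sum_recenter (I : finType) (F : fieldType) (V : lmodType F) (J : {set I})
    (b : I -> F) (x : I -> V) (y z : V) :
  \sum_(j in J) b j *: (x j - y) =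
  \sum_(j in J) b j *: (x j - z) + (\sum_(j in J) b j) *: (z - y).
Proof.
rewrite scaler_suml -big_split /=; apply: eq_bigr => j _.
by rewrite -scalerDr addrA subrK.
Qed.

Lemma sum_affine_multiple (I : finType) (F : fieldType) (V : lmodType F)
    (J : {set I}) (c b : I -> F) (x : I -> V) (y : V) lam :
  \sum_(j in J) c j = 1 -> \sum_(j in J) c j *: x j = y ->
  (forall j, j \in J -> b j = lam * c j) ->
  \sum_(j in J) b j *: (x j - y) = 0 /\ \sum_(j in J) b j = lam.
Proof.
move=> c1 xy bE; split; last by rewrite (eq_bigr _ bE) -mulr_sumr c1 mulr1.
transitivity (\sum_(j in J) lam *: (c j *: x j - c j *: y)).
  by apply: eq_bigr => j jJ; rewrite bE // -scalerA scalerBr.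
by rewrite -scaler_sumr sumrB xy -scaler_suml c1 scale1r subrr scaler0.
Qed.

(** The point [z] standing for the remaining variables is taken in a subset [T] of [S] all of whose
    points are spread in [S], modulo a subspace enlarged by the differences already used. Hence the
    induction is uniform in [K]. *)
Lemma spread_forced (R : realType) (F : finFieldType) (I : finType)
    (J : {set I}) (c : I -> F) K :
  (forall j, j \in J -> c j != 0) -> \sum_(j in J) c j = 1 ->
  forced R (fun n (T : {set 'rV[F]_n}) => exists2 y, y \in T & spread J c K T y).
Proof.
have [m] := ubnP #|J|; elim: m J c K => // m IH J c K Jm c0 c1.
have [/exists_inP [i iJ ci1]|/exists_inPn call] := boolP [exists i in J, c i != 1].
  pose c' j := c j / (1 - c i).
  have ci1' : 1 - c i != 0 by rewrite subr_eq0 eq_sym.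
  have c'0 j : j \in J :\ i -> c' j != 0.
    by move=> /setD1P [_ /c0 cj0]; rewrite mulf_neq0 // invr_eq0.
  have c'1 : \sum_(j in J :\ i) c' j = 1.
    rewrite -mulr_suml; suff -> : \sum_(j in J :\ i) c j = 1 - c i by rewrite mulfV.
    by have := c1; rewrite (big_setD1 i iJ) /= => <-; rewrite addrAC subrr add0r.
  have Jim : (#|J :\ i| < m)%N by move: Jm; rewrite (cardsD1 i J) iJ.
  have := forced_within (@spread_sub _ _ (J :\ i) c' K.+1)
    (three_term_forced R K (c0 i iJ) ci1) (IH _ _ K.+1 Jim c'0 c'1).
  apply: forced_imp => n S [T [TS [y yT hy] hT]].
  exists y; first exact: (subsetP TS).
  move=> U; have [x1 [z [x1T zT ye x1U]]] := hy U.
  have [x [xS xz xU]] := hT z zT (col_mx (z - y) U).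
  have zy : (1 - c i) *: (z - y) = - (c i *: (x1 - y)).
    apply/eqP; rewrite -subr_eq0 opprK !scalerBr addrACA -opprD -scalerDl subrK.
    by rewrite scale1r [_ *: z + _]addrC -ye subrr.
  pose x' j := if j == i then x1 else x j.
  have x'i : x' i = x1 by rewrite /x' eqxx.
  have x'x (G : I -> 'rV[F]_n -> 'rV[F]_n) :
      \sum_(j in J :\ i) G j (x' j) = \sum_(j in J :\ i) G j (x j).
    by apply: eq_bigr => j /setD1P [/negPf ji _]; rewrite /x' ji.
  exists x'; split.
  - move=> j jJ; have [->|ji] := eqVneq j i; first by rewrite x'i (subsetP TS).
    by rewrite /x' (negPf ji) xS // !inE ji.
  - rewrite (big_setD1 i) //= x'i (x'x (fun j v => c j *: v)) ye; congr (_ + _).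
    rewrite -xz scaler_sumr; apply: eq_bigr => j _.
    by rewrite scalerA /c' mulrC divfK.
  move=> b; rewrite (big_setD1 i) //= x'i (x'x (fun j v => b j *: (v - y))).
  rewrite (sum_recenter _ _ _ _ z) => hb.
  have [lam hlam] : exists lam, forall j, j \in J :\ i -> b j = lam * c' j.
    apply/xU/(@sub_col_mx_add F 1 K n _ _
      (b i *: (x1 - y) + (\sum_(j in J :\ i) b j) *: (z - y))).
      have x1y : (x1 - y <= z - y)%MS.
        rewrite -(eqmx_scale _ (c0 i iJ)) -(opprK (c i *: _)) -zy eqmx_opp.
        exact: scalemx_sub.
      exact: addmx_sub (scalemx_sub _ x1y) (scalemx_sub _ (submx_refl _)).
    by rewrite -addrA [X in (_ + X)%R]addrC; apply: hb.
  have [s0 sl] := sum_affine_multiple c'1 xz hlam.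
  exists (lam / (1 - c i)) => j jJ; have [->|ji] := eqVneq j i; last first.
    by rewrite hlam ?inE ?ji // /c' mulrA mulrAC.
  (* The remaining terms add up to [lam *: (z - y)], a multiple of [x1 - y]; since [x1 - y] is not
     in [U], its total coefficient is 0. *)
  move: hb; rewrite s0 sl add0r => hb.
  have : (((1 - c i) * b i - lam * c i) *: (x1 - y) <= U)%MS.
    rewrite scalerBl -!scalerA -scalerN -zy [lam *: _]scalerA [lam * _]mulrC.
    by rewrite -scalerA -scalerDr scalemx_sub.
  have [/eqP|nz] := eqVneq ((1 - c i) * b i - lam * c i) 0.
    rewrite subr_eq0 => /eqP e _; apply: (mulfI ci1'); rewrite e.
    by rewrite mulrA [_ * (lam / _)]mulrC divfK.
  by rewrite eqmx_scale // (negPf x1U).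
have [J0|[i1 i1J]] := set_0Vmem J.
  by move: c1; rewrite J0 big_set0 => /eqP; rewrite eq_sym oner_eq0.
have cE j : j \in J -> c j = 1 by move=> /call; rewrite negbK => /eqP.
have [J10|[i2 i2J]] := set_0Vmem (J :\ i1).
  (* A single variable of weight 1 represents [y] by [y] itself, so a nonempty [T] suffices. *)
  exists 1, 1; rewrite ltr01 ltr1n card_finNzRing_gt1; do 3!split=> //.
  move=> n T; rewrite expr1n mulr1 ler1n => /card_gt0P [y yT]; exists y => // U.
  exists (fun=> y); split=> //; first by rewrite -scaler_suml c1 scale1r.
  move=> b _; exists (b i1) => j jJ; rewrite cE // mulr1.
  have : j \notin J :\ i1 by rewrite J10 inE.
  by rewrite !inE jJ andbT negbK => /eqP ->.
set J2 := J :\ i1 :\ i2.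
have J2J j : j \in J2 -> j \in J by move=> /setD1P [_ /setD1P []].
(* All weights are 1, so [|J| = 1] in [F]. In [y = x1 + x2 - z], the other [|J| - 2] variables
   represent [z] with weights -1, of sum 1. *)
have c'1 : \sum_(j in J2) (-1 : F) = 1.
  rewrite sumrN -[RHS]opprK; congr (- _); apply: (addrI 1); rewrite subrr.
  apply: (addrI 1); rewrite addr0 -[RHS]c1 (big_setD1 i1 i1J) (big_setD1 i2 i2J) /=.
  rewrite !cE //; last by case/setD1P: i2J.
  by congr (_ + (_ + _)); apply: eq_bigr => j /J2J /cE.
have J2m : (#|J2| < m)%N.
  by move: Jm; rewrite (cardsD1 i1 J) i1J (cardsD1 i2) i2J -/J2; lia.
have c'0 j : j \in J2 -> (-1 : F) != 0 by rewrite oppr_eq0 oner_eq0.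
have := forced_within (@spread_sub _ _ J2 (fun=> -1 : F) K.+2)
  (parallelogram_forced R F K) (IH J2 (fun=> -1) K.+2 J2m c'0 c'1).
apply: forced_imp => n S [T [TS [y yT hy] hT]].
exists y; first exact: (subsetP TS).
move=> U; have [x1 [x2 [z [x1T x2T zT e xU]]]] := hy U.
have [x [xS xz xU']] := hT z zT (col_mx (col_mx (x1 - y) (x2 - y)) U).
have i21 : i2 != i1 by case/setD1P: i2J.
have i2J' : i2 \in J by case/setD1P: i2J.
pose x' j := if j == i1 then x1 else if j == i2 then x2 else x j.
have x'1 : x' i1 = x1 by rewrite /x' eqxx.
have x'2 : x' i2 = x2 by rewrite /x' (negPf i21) eqxx.
have x'x (G : I -> 'rV[F]_n -> 'rV[F]_n) :
    \sum_(j in J2) G j (x' j) = \sum_(j in J2) G j (x j).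
  by apply: eq_bigr => j /setD1P [/negPf j2 /setD1P [/negPf j1 _]]; rewrite /x' j1 j2.
have split_sum (G : I -> 'rV[F]_n) :
    \sum_(j in J) G j = G i1 + (G i2 + \sum_(j in J2) G j).
  by rewrite (big_setD1 i1 i1J) (big_setD1 i2 i2J).
have zy : z - y = (x1 - y) + (x2 - y) by rewrite addrACA e addrACA subrr add0r.
exists x'; split.
- move=> j jJ; have [->|j1] := eqVneq j i1; first by rewrite x'1 (subsetP TS).
  have [->|j2] := eqVneq j i2; first by rewrite x'2 (subsetP TS).
  by rewrite /x' (negPf j1) (negPf j2) xS // !inE j1 j2.
- rewrite split_sum x'1 x'2 (x'x (fun j v => c j *: v)) !cE // !scale1r.
  rewrite (eq_bigr (fun j => - (-1 *: x j))) => [|j /J2J /cE ->]; last first.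
    by rewrite scaleN1r opprK scale1r.
  by rewrite sumrN xz addrA e addrK.
move=> b; rewrite split_sum x'1 x'2 (x'x (fun j v => b j *: (v - y))).
rewrite (sum_recenter _ _ _ _ z) zy => hb.
have [lam hlam] : exists lam, forall j, j \in J2 -> b j = lam * -1.
  apply/xU'/(@sub_col_mx_add F 2 K n _ _ (b i1 *: (x1 - y) + b i2 *: (x2 - y)
    + (\sum_(j in J2) b j) *: ((x1 - y) + (x2 - y)))).
    have s1 : (x1 - y <= col_mx (x1 - y) (x2 - y))%MS.
      by rewrite -addsmxE addsmxSl.
    have s2 : (x2 - y <= col_mx (x1 - y) (x2 - y))%MS.
      by rewrite -addsmxE addsmxSr.
    by rewrite !addmx_sub ?scalemx_sub // addmx_sub.
  by rewrite -addrA -addrA [X in (_ + (_ + X))%R]addrC; apply: hb.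
have [s0 sl] := sum_affine_multiple c'1 xz hlam.
move: hb; rewrite s0 sl add0r [lam *: _]scalerDr addrA addrACA -!scalerDl.
move=> /xU [/eqP b1 /eqP b2].
move: b1 b2; rewrite !addr_eq0 => /eqP b1 /eqP b2.
exists (- lam) => j jJ; rewrite cE // mulr1.
have [->//|j1] := eqVneq j i1; have [->//|j2] := eqVneq j i2.
by rewrite hlam ?mulrN1 // !inE j1 j2.
Qed.

(** * Collapsing systems *)

(** The class points [p i] are spread, so the variables of class [i] can represent [p i] with
    weights [c]. The classes are treated in turn, each modulo the span of all points [p] and of the
    variables chosen before, whence the bound [#|I| + k]. *)
Lemma refine_forced (R : realType) (F : finFieldType) (I : finType) (k : nat)
    (pi : 'I_k -> I) (c : 'I_k -> F) (Phi : forall n, (I -> 'rV[F]_n) -> Prop) :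
  (forall j, c j != 0) ->
  (forall j, \sum_(j' in [set j' | pi j' == pi j]) c j' = 1) ->
  forced R (fun n (S : {set 'rV[F]_n}) =>
    exists p, (forall i, p i \in S) /\ Phi n p) ->
  forced R (fun n (S : {set 'rV[F]_n}) => exists p x,
    [/\ forall j, x j \in S, Phi n p,
      forall lam, \sum_j (lam (pi j) * c j) *: x j =
                  \sum_j (lam (pi j) * c j) *: p (pi j) &
      forall b, \sum_j b j *: x j = 0 ->
        exists lam, forall j, b j = lam (pi j) * c j]).
Proof.
move=> c0 c1 hPhi; pose J i := [set j | pi j == i].
(* Only classes that occur: an empty one would have weight sum 0 and represent nothing. *)
pose s := undup (codom pi).
have sP i : i \in s -> exists j, i = pi j.
  by rewrite mem_undup => /codomP.
have pis j : pi j \in s by rewrite mem_undup codom_f.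
have Jsum i : i \in s -> \sum_(j in J i) c j = 1.
  by move=> /sP [j ->]; exact: c1.
have hspread i : i \in s -> forced R (fun n (T : {set 'rV[F]_n}) =>
    exists2 y, y \in T & spread (J i) c (#|I| + k) T y).
  by move=> /Jsum Ji; apply: spread_forced.
have := forced_within_seq (fun i => @spread_sub _ _ (J i) c (#|I| + k)) hPhi hspread.
apply: forced_imp => n S [T [TS [p [pT Phip]] hT]].
have pS i : p i \in S by apply: (subsetP TS).
pose Pm : 'M[F]_(#|I|, n) := \matrix_i p (enum_val i).
have pPm i : (p i <= Pm)%MS.
  by have := row_sub (enum_rank i) Pm; rewrite rowK enum_rankK.
(* Induction on the list [r] of treated classes, with relations taken modulo the span of the class
   points; variables not yet treated hold the placeholder [p (pi j)]. *)
have build r : uniq r -> {subset r <= s} -> exists x : 'I_k -> 'rV[F]_n,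
    [/\ forall j, x j \in S,
      forall i, i \in r -> \sum_(j in J i) c j *: x j = p i &
      forall b, ((\sum_(j | pi j \in r) b j *: (x j - p (pi j)))%R <= Pm)%MS ->
        forall i, i \in r -> exists lam, forall j, j \in J i -> b j = lam * c j].
  elim: r => [|i r IH] /=; first by exists (fun j => p (pi j)); split.
  move=> /andP [ir ur] rs; have is_ : i \in s by apply: rs; rewrite mem_head.
  have [|x [xS xp xb]] := IH ur.
    by move=> i' i'r; apply: rs; rewrite inE i'r orbT.
  have [x1 [x1S x1p x1U]] :=
    hT (p i) i (pT i) is_ (col_mx Pm (\matrix_j x j)).
  pose x' j := if pi j == i then x1 j else x j.
  have x'1 (G : 'I_k -> 'rV[F]_n -> 'rV[F]_n) :
      \sum_(j in J i) G j (x' j) = \sum_(j in J i) G j (x1 j).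
    by apply: eq_bigr => j; rewrite inE /x' => ->.
  have x'r (G : 'I_k -> 'rV[F]_n -> 'rV[F]_n) :
      \sum_(j | pi j \in r) G j (x' j) = \sum_(j | pi j \in r) G j (x j).
    apply: eq_bigr => j jr; rewrite /x'; case: eqP => // e.
    by rewrite -e jr in ir.
  exists x'; split.
  - by move=> j; rewrite /x'; case: eqP => // e; apply: x1S; rewrite inE e.
  - move=> i'; rewrite inE => /orP [/eqP ->|i'r]; first by rewrite (x'1 (fun j v => c j *: v)).
    rewrite -xp //; apply: eq_bigr => j; rewrite inE /x' => /eqP e.
    by rewrite e; case: eqP => // e'; rewrite -e' i'r in ir.
  move=> b; rewrite (bigID (fun j => j \in J i)) /=.
  rewrite (eq_bigl (fun j => j \in J i)) => [|j]; last first.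
    by rewrite !inE; case: eqP; rewrite ?andbF ?andbT.
  rewrite (eq_bigr (fun j => b j *: (x' j - p i))) => [|j]; last first.
    by rewrite inE => /eqP ->.
  rewrite (x'1 (fun j v => b j *: (v - p i))).
  rewrite [X in (_ + X)%R](eq_bigl (fun j => pi j \in r)) => [|j]; last first.
    by rewrite !inE; case: eqP => [->|]; rewrite ?andbF ?andbT // (negPf ir).
  rewrite (x'r (fun j v => b j *: (v - p (pi j)))) => hb.
  have [lam hlam] : exists lam, forall j, j \in J i -> b j = lam * c j.
    apply: x1U; rewrite -[X in (X <= _)%MS](addrK (\sum_(j | pi j \in r)
      b j *: (x j - p (pi j)))) addmx_sub //.
      by apply: submx_trans hb _; rewrite -addsmxE addsmxSl.
    rewrite eqmx_opp; apply: summx_sub => j _; rewrite scalemx_sub //.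
    rewrite addmx_sub ?eqmx_opp //.
      apply: submx_trans (_ : _ <= \matrix_j x j)%MS _.
        by have := row_sub j (\matrix_j x j); rewrite rowK.
      by rewrite -addsmxE addsmxSr.
    by apply: submx_trans (pPm _) _; rewrite -addsmxE addsmxSl.
  have [s0 _] := sum_affine_multiple (Jsum i is_) x1p hlam.
  move: hb; rewrite s0 add0r => /xb hr i'; rewrite inE => /orP [/eqP ->|/hr //].
  by exists lam.
have [x [xS xp xb]] := build s (undup_uniq _) (fun i => id).
exists p, x; split=> // [lam|b bx].
  rewrite (partition_big pi (mem s) (fun j _ => pis j)).
  rewrite [RHS](partition_big pi (mem s) (fun j _ => pis j)) /=.
  apply: eq_bigr => i is_.
  transitivity (lam i *: \sum_(j in J i) c j *: x j).
    rewrite scaler_sumr; apply: eq_big => [j|j /eqP ->]; last by rewrite scalerA.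
    by rewrite inE.
  rewrite xp // -[p i in LHS]scale1r -(Jsum i is_) scaler_suml scaler_sumr.
  by apply: eq_big => [j|j]; rewrite inE // => /eqP ->; rewrite scalerA.
have bS : ((\sum_(j | pi j \in s) b j *: (x j - p (pi j)))%R <= Pm)%MS.
  rewrite (eq_bigl xpredT) => [|j]; last by rewrite pis.
  under eq_bigr do rewrite scalerBr.
  rewrite sumrB bx sub0r eqmx_opp; apply: summx_sub => j _.
  by rewrite scalemx_sub.
have /choice [lam hlam] : forall i, exists lam, i \in s ->
    forall j, j \in J i -> b j = lam * c j.
  move=> i; case is_: (i \in s); last by exists 0.
  by have [lam hl] := xb b bS i is_; exists lam.
by exists lam => j; apply: (hlam _ (pis j)); rewrite inE.
Qed.

(** With a right inverse [C'] of [C], the map sending [(X, Y)] to [X + C' *m Y] is injective for [X]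
    in the kernel. *)
Lemma card_kernel_le (F : finFieldType) m N n (C : 'M[F]_(m, N)) :
  row_free C ->
  (#|[set X : 'M_(N, n) | C *m X == 0%R]| * #|F| ^ (m * n) <= #|F| ^ (N * n))%N.
Proof.
move=> /row_freeP [C' CC']; rewrite -!card_mx -!cardsT -cardsX.
pose f (t : 'M[F]_(N, n) * 'M[F]_(m, n)) := t.1 + C' *m t.2.
rewrite -(card_in_imset (f := f)); first exact/subset_leq_card/subsetT.
move=> [X Y] [X' Y']; rewrite !inE !andbT /= => /eqP X0 /eqP X'0; rewrite /f /= => e.
have eY : Y = Y'.
  have := congr1 (mulmx C) e.
  by rewrite !mulmxDr X0 X'0 !add0r !mulmxA CC' !mul1mx.
by move: e; rewrite eY => /addIr ->.
Qed.

Lemma row_free_col_mx (F : fieldType) m N (D : 'M[F]_(m, N)) (t : 'rV_N) :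
  row_free D -> ~~ (t <= D)%MS -> row_free (col_mx D t).
Proof.
move=> /eqP Dm tD; rewrite /row_free eqn_leq rank_leq_row /=.
suff : (\rank D < \rank (col_mx D t))%N by rewrite Dm -addn1.
apply: rank_ltmx; rewrite ltmxE -addsmxE addsmxSl /=.
by apply: contra tD => h; apply: submx_trans h; rewrite ?addsmxE -addsmxE addsmxSr.
Qed.

(** By Cauchy-Schwarz at least [|S|^(2k) / q^(m n)] pairs of tuples in [S^k] satisfy [B w = B z]. A
    relation outside the row space of [D = [B, -B]] makes [m + 1] independent equations, with
    [q^((2k - m - 1) n)] solutions, and there are at most [q^(2k)] such relations. *)
Lemma duplicated_system_forced (R : realType) (F : finFieldType) m k
    (B : 'M[F]_(m, k)) :
  row_free B ->
  forced R (fun n (S : {set 'rV[F]_n}) => exists p : 'I_k * bool -> 'rV[F]_n,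
    (forall i, p i \in S) /\
    ((forall r, \sum_i B r i *: p (i, true) = \sum_i B r i *: p (i, false)) /\
     forall lam : 'I_k * bool -> F, \sum_i lam i *: p i = 0 ->
       exists mu : 'rV_m, forall i,
         lam (i, true) = (mu *m B) 0 i /\ lam (i, false) = - (mu *m B) 0 i)).
Proof.
have [k0 _|k0 Bfree] := posnP k.
  have noI (i : 'I_k) : False by have := ltn_ord i; rewrite [X in (_ < X)%N]k0.
  exists 1, 1; rewrite ltr01 ltr1n card_finNzRing_gt1; do 3!split=> //.
  move=> n S _; exists (fun=> 0); split=> [[i]|]; first by case: (noI i).
  split=> [r|lam _]; first by rewrite !big1 // => i; case: (noI i).
  by exists 0 => i; case: (noI i).
pose D := row_mx B (- B).
have Dfree : row_free D.
  rewrite /row_free eqn_leq rank_leq_row /= -{1}(eqP Bfree).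
  have -> : B = D *m col_mx 1%:M 0 by rewrite mul_row_col mulmx1 mulmx0 addr0.
  exact: mxrankM_maxl.
apply: (@forced_of_card_exp _ _ _ (#|F| ^ (k + k)) (k + k).-1) => n S.
rewrite prednK ?addn_gt0 ?k0 // => hS; apply: contrapT => nop.
pose W (w : {ffun 'I_k -> 'rV[F]_n}) : 'M_(k, n) := \matrix_i w i.
pose A := [set w : {ffun 'I_k -> 'rV[F]_n} | w \in ffun_on (mem S)].
have := card_collisions_ge (fun w => B *m W w) A.
have -> : #|A| = (#|S| ^ k)%N by rewrite cardsE card_ffun_on card_ord.
rewrite card_mx; set P := [set p in _ | _] => hP.
pose g (t : {ffun 'I_k -> 'rV[F]_n} * {ffun 'I_k -> 'rV[F]_n}) :=
  col_mx (W t.1) (W t.2).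
have ginj : injective g.
  move=> [w z] [w' z'] /eq_col_mx [/= /row_matrixP ew /row_matrixP ez].
  by congr pair; apply/ffunP => i; [have := ew i|have := ez i]; rewrite !rowK.
pose Sol (t : 'rV[F]_(k + k)) := [set X : 'M[F]_(k + k, n) | col_mx D t *m X == 0].
pose Z := \bigcup_(t | ~~ (t <= D)%MS) Sol t.
have gPZ : g @: P \subset Z.
  apply/subsetP => _ /imsetP [[w z] wzP ->].
  move: wzP; rewrite !inE /= => /andP [/andP [wA zA] /eqP Bwz].
  apply: contrapT => nZ; apply: nop.
  exists (fun i => if i.2 then w i.1 else z i.1); split=> [[i []] /=|].
  - by move/ffun_onP: wA; apply.
  - by move/ffun_onP: zA; apply.
  split=> [r|lam].
    have /row_matrixP/(_ r) := Bwz; rewrite !row_mul !mulmx_sum_row => e.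
    transitivity (\sum_i row r B 0 i *: row i (W w)).
      by apply: eq_bigr => i _; rewrite rowK mxE.
    by rewrite e; apply: eq_bigr => i _; rewrite rowK mxE.
  move=> lamp; have lam0 :
      \sum_i (lam (i, true) *: w i + lam (i, false) *: z i) = 0.
    rewrite -[RHS]lamp.
    rewrite (eq_bigr (fun i => \sum_s lam (i, s) *: (if s then w i else z i))).
      by rewrite pair_bigA; apply: eq_bigr => -[].
    by move=> i _; rewrite big_bool.
  pose t := row_mx (\row_i lam (i, true)) (\row_i lam (i, false)).
  have [/submxP [mu]|tD] := boolP (t <= D)%MS.
    rewrite mul_mx_row mulmxN => /eq_row_mx [/rowP e1 /rowP e2]; exists mu => i.
    by have := e1 i; have := e2 i; rewrite !mxE => -> ->.
  case: nZ; apply/bigcupP; exists t => //; rewrite inE mul_col_mx.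
  rewrite !mul_row_col mulNmx Bwz subrr; apply/eqP.
  suff -> : \row_i lam (i, true) *m W w + \row_i lam (i, false) *m W z = 0.
    by rewrite col_mx0.
  rewrite -[RHS]lam0 !mulmx_sum_row -big_split; apply: eq_bigr => i _.
  by rewrite !rowK !mxE.
have cZ : (#|Z| * #|F| ^ (m.+1 * n) <= #|F| ^ (k + k) * #|F| ^ ((k + k) * n))%N.
  have bU : (#|Z| <= \sum_(t : 'rV[F]_(k + k) | ~~ (t <= D)%MS) #|Sol t|)%N.
    apply: (big_ind2 (fun (X : {set 'M[F]_(k + k, n)}) c => (#|X| <= c)%N)) => //.
      by rewrite cards0.
    move=> X c Y d Xc Yd; apply: leq_trans (leq_card_setU _ _) _.
    exact: leq_add.
  apply: leq_trans (leq_mul bU (leqnn _)) _; rewrite big_distrl /=.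
  apply: leq_trans (_ : \sum_(t : 'rV[F]_(k + k) | ~~ (t <= D)%MS)
     #|F| ^ ((k + k) * n) <= _)%N.
    apply: leq_sum => t tD; rewrite -addn1; apply: card_kernel_le.
    exact: row_free_col_mx.
  rewrite sum_nat_const leq_mul2r; apply/orP; right.
  by apply: leq_trans (max_card _) _; rewrite card_mx mul1n.
have cP : (#|P| <= #|Z|)%N.
  by rewrite -(card_imset _ ginj); apply: subset_leq_card.
move: hS; apply/negP; rewrite -leqNgt.
have qn0 : (0 < #|F| ^ n)%N by rewrite expn_gt0 (ltnW (card_finNzRing_gt1 F)).
rewrite -(leq_pmul2r qn0) -mulnA -expnD.
have -> : (n * (k + k).-1 + n = (k + k) * n)%N by move: k0; case: (k) => // k' _; lia.
apply: leq_trans cZ; rewrite mulSn (expnD #|F|) mulnC mulnCA leq_pmul2l //.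
have -> : (#|S| ^ (k + k) = (#|S| ^ k) ^ 2)%N by rewrite -mulnn -expnD.
apply: leq_trans hP _.
by rewrite mulnC leq_mul2r cP orbT.
Qed.

(** Otherwise [A] and [b] would span, by rank, the whole row space of [E], and [w] would kill [e].
    It is applied with [w] the all-ones vector. *)
Lemma submx_of_codim1 (F : fieldType) m l k (A : 'M[F]_(m, k)) (E : 'M_(l, k))
    (b e : 'rV_k) (w : 'cV_k) :
  row_free A -> (l <= m.+1)%N -> (A <= E)%MS -> (b <= E)%MS -> (e <= E)%MS ->
  A *m w = 0 -> b *m w = 0 -> e *m w != 0 -> (b <= A)%MS.
Proof.
move=> Afree lm AE bE eE Aw bw ew; apply: contraT => bA.
have /eqP Vm := row_free_col_mx Afree bA.
have : (\rank (col_mx A b) < \rank E)%N.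
  apply: rank_ltmx; rewrite ltmxE -addsmxE addsmx_sub AE bE /=.
  apply: contra ew => /(submx_trans eE) /submxP [a ->].
  by rewrite -mulmxA mul_col_mx Aw bw col_mx0 mulmx0.
have := rank_leq_row E; rewrite Vm addn1; lia.
Qed.

(** * Column classes *)

Section ColumnClasses.
Variables (F : finFieldType) (m k : nat) (A : 'M[F]_(m, k)).

Lemma col_equivP j j' :
  reflect (exists2 c, c != 0 & col j A = c *: col j' A) (col_equiv A j j').
Proof.
apply: (iffP existsP) => [[c /andP [c0 /eqP e]]|[c c0 e]]; first by exists c.
by exists c; rewrite c0 e eqxx.
Qed.

Lemma col_equiv_refl j : col_equiv A j j.
Proof. by apply/col_equivP; exists 1; rewrite ?oner_neq0 // scale1r. Qed.

Lemma col_equiv_sym j j' : col_equiv A j j' -> col_equiv A j' j.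
Proof.
move=> /col_equivP [c c0 e]; apply/col_equivP; exists c^-1; rewrite ?invr_eq0 //.
by rewrite e scalerA mulVf // scale1r.
Qed.

Lemma col_equiv_trans j1 j2 j3 :
  col_equiv A j1 j2 -> col_equiv A j2 j3 -> col_equiv A j1 j3.
Proof.
move=> /col_equivP [c c0 e] /col_equivP [d d0 e']; apply/col_equivP.
by exists (c * d); rewrite ?mulf_neq0 // e e' scalerA.
Qed.

Lemma col_class_eq j j' : (col_class A j == col_class A j') = (j' \in col_class A j).
Proof.
rewrite inE; apply/eqP/idP => [e|jj'].
  by have := col_equiv_refl j'; rewrite -[_ j' j']in_set -/(col_class A j') -e inE.
apply/setP => i; rewrite !inE; apply/idP/idP; apply: col_equiv_trans => //.
exact: col_equiv_sym.
Qed.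

Lemma col_classE j : [set j' | col_class A j' == col_class A j] = col_class A j.
Proof. by apply/setP => j'; rewrite inE eq_sym col_class_eq. Qed.

(** Column [j] is [c j *: s C], with [s C] the nonzero sum of its class [C]; then [c] sums to 1 on
    [C], and the class points enter with coefficients [s C], so equal points solve the balanced
    system. A relation [b] lies in the span [E] of the class weights, of dimension [m + 1], in which
    the row space of [A] is the hyperplane of balanced vectors. *)
Lemma temperate_no_class_sums_zero (R : realType) :
  balanced_sys A -> row_free A -> (forall j, col j A != 0) ->
  (forall C, C \in col_classes A -> ~~ class_sums_zero A C) ->
  #|col_classes A| = m.+1 -> temperate A R.
Proof.
move=> bal Afree colnz nz ell.
pose s (C : {set 'I_k}) := \sum_(j in C) col j A.
have /choice [c cE] : forall j, exists c, col j A = c *: s (col_class A j).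
  move=> j; have /choice [d dE] : forall j', exists d, j' \in col_class A j ->
      col j' A = d *: col j A.
    move=> j'; have [|_] := boolP (j' \in col_class A j); last by exists 0.
    by rewrite inE => /col_equiv_sym /col_equivP [d _ e]; exists d.
  have sE : s (col_class A j) = (\sum_(j' in col_class A j) d j') *: col j A.
    by rewrite scaler_suml; apply: eq_bigr.
  have s0 : s (col_class A j) != 0 by apply/nz/imset_f.
  exists (\sum_(j' in col_class A j) d j')^-1; rewrite sE scalerA mulVf ?scale1r //.
  by apply: contra_neq s0 => d0; rewrite sE d0 scale0r.
have sn0 j : s (col_class A j) != 0 by apply/nz/imset_f.
have c0 j : c j != 0.
  by apply: contra_neq (colnz j) => cj0; rewrite cE cj0 scale0r.
have csum j : \sum_(j' in [set j' | col_class A j' == col_class A j]) c j' = 1.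
  apply/eqP; rewrite -subr_eq0 col_classE.
  have : (\sum_(j' in col_class A j) c j' - 1) *: s (col_class A j) == 0.
    rewrite scalerBl scale1r scaler_suml subr_eq0; apply/eqP/eq_bigr => j' jj'.
    by rewrite cE; congr (_ *: s _); apply/eqP; rewrite col_class_eq.
  by rewrite scaler_eq0 (negPf (sn0 j)) orbF.
have entryE r j : A r j = s (col_class A j) r 0 * c j.
  by have /colP/(_ r) := cE j; rewrite !mxE mulrC.
pose Phi n (p : {set 'I_k} -> 'rV[F]_n) := forall C C', p C = p C'.
have hPhi : forced R (fun n (S : {set 'rV[F]_n}) =>
    exists p, (forall C, p C \in S) /\ Phi n p).
  exists 1, 1; rewrite ltr01 ltr1n card_finNzRing_gt1; do 3!split=> //.
  move=> n S; rewrite expr1n mulr1 ler1n => /card_gt0P [y yS].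
  by exists (fun=> y).
apply: forced_imp (refine_forced c0 csum hPhi) => n S [p [x [xS pconst xp xb]]].
exists x; split=> //; split=> [r|b bbal bx].
  have := xp (fun C => s C r 0); under eq_bigr do rewrite -entryE.
  move=> ->; under eq_bigr do rewrite -entryE (pconst _ setT).
  rewrite -scaler_suml; have /eqP := bal r; under eq_bigr do rewrite mxE.
  by move=> ->; rewrite scale0r.
have [lam bE] := xb (fun j => b 0 j) bx.
(* A nonzero [b] supplies an index [j0], whose class weights form the unbalanced vector [e]
   below. *)
have [->|/rV0Pn [j0 _]] := eqVneq b 0; first exact: sub0mx.
pose E : 'M[F]_(#|col_classes A|, k) :=
  \matrix_(r, j) (c j *+ (col_class A j == enum_val r)).
have inE' j : col_class A j \in col_classes A by apply: imset_f.
have EP (v : 'rV_k) mu : (forall j, v 0 j = mu (col_class A j) * c j) -> (v <= E)%MS.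
  move=> vE; apply/submxP; exists (\row_r mu (enum_val r)); apply/rowP => j.
  rewrite vE mxE (bigD1 (enum_rank_in (inE' j) (col_class A j))) //= !mxE.
  rewrite enum_rankK_in // eqxx mulr1n big1 ?addr0 // => r rj.
  rewrite !mxE; case: eqP => [e|]; last by rewrite mulr0n mulr0.
  by case/eqP: rj; apply: enum_val_inj; rewrite enum_rankK_in.
pose w : 'cV[F]_k := const_mx 1.
have vw (v : 'rV_k) : (v *m w) 0 0 = \sum_j v 0 j.
  by rewrite mxE; apply: eq_bigr => j _; rewrite mxE mulr1.
apply: (submx_of_codim1 (E := E) (w := w)
  (e := \row_j (c j *+ (col_class A j == col_class A j0)))) => //.
- by rewrite ell.
- apply/row_subP => r; apply: (EP _ (fun C => s C r 0)) => j.
  by rewrite mxE entryE.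
- exact: EP bE.
- apply: (EP _ (fun C => (C == col_class A j0)%:R)) => j.
  by rewrite mxE mulr_natl.
- apply/row_matrixP => r; rewrite row_mul row0; apply/rowP => i; rewrite ord1 vw mxE.
  exact/eqP/bal.
- by apply/rowP => i; rewrite ord1 vw mxE; apply/eqP.
- apply/eqP => /rowP/(_ 0); rewrite vw mxE.
  under eq_bigr do rewrite mxE mulrb.
  rewrite -big_mkcond /=; rewrite -(eq_bigl _ _ (fun j => in_set _ j)) csum.
  by move/eqP; rewrite oner_eq0.
Qed.

(** The columns of a class are multiples [d j] of the representative's, with [d] of sum 0 and equal
    to 1 at the representative. So the other variables, with weights [- d j] of sum 1, represent a
    point [z], and the class contributes its representative column times [w - z]. *)
Lemma temperate_all_classes_sum_zero (R : realType) :
  row_free A -> (forall j, col j A != 0) ->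
  (forall C, C \in col_classes A -> class_sums_zero A C) -> temperate A R.
Proof.
move=> Afree colnz zero.
(* [pick] depends on the set only, so equivalent indices share a representative; the default [j]
   never occurs, as the class contains [j]. *)
pose rep j := odflt j [pick j' in col_class A j].
have rep_in j : rep j \in col_class A j.
  rewrite /rep; case: pickP => [//|/(_ j)]; by rewrite inE col_equiv_refl.
have rep_eq j j' : (rep j == rep j') = (col_class A j == col_class A j').
  apply/eqP/eqP => [e|e].
    have /eqP -> : col_class A j == col_class A (rep j) by rewrite col_class_eq.
    by apply/esym/eqP; rewrite e col_class_eq.
  rewrite /rep e; case: pickP => [//|/(_ j')]; by rewrite inE col_equiv_refl.
have repK j : rep (rep j) = rep j.
  by apply/esym/eqP; rewrite rep_eq col_class_eq.
have /choice [d dE] : forall j, exists d, col j A = d *: col (rep j) A.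
  move=> j; have := rep_in j; rewrite inE => /col_equivP [d _ e]; by exists d.
have d0 j : d j != 0.
  by apply: contra_neq (colnz j) => dj0; rewrite dE dj0 scale0r.
have d1 j : rep j = j -> d j = 1.
  move=> rj; have /eqP := dE j; rewrite rj -[X in X == _]scale1r -subr_eq0 -scalerBl.
  by rewrite scaler_eq0 (negPf (colnz j)) orbF subr_eq0 eq_sym => /eqP.
have dsum j : \sum_(j' | rep j' == rep j) d j' = 0.
  have : (\sum_(j' | rep j' == rep j) d j') *: col (rep j) A == 0.
    have := zero _ (imset_f (col_class A) (isT : j \in 'I_k)).
    rewrite /class_sums_zero => /eqP h; rewrite -[X in _ == X]h scaler_suml.
    apply/eqP/eq_big => [j'|j' /eqP e]; last by rewrite [RHS]dE e.
    by rewrite rep_eq eq_sym col_class_eq.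
  by rewrite scaler_eq0 (negPf (colnz _)) orbF => /eqP.
pose pi j := (rep j, j == rep j).
pose c j := if j == rep j then 1 else - d j.
have c0 j : c j != 0 by rewrite /c; case: ifP; rewrite ?oner_neq0 ?oppr_eq0.
have csum i t : rep i = i -> \sum_(j in [set j | pi j == (i, t)]) c j = 1.
  move=> ri; have := dsum i; rewrite (bigD1 i) ?ri //= (d1 i ri) => /eqP.
  rewrite addrC addr_eq0 => /eqP sd; case: t.
    rewrite (big_pred1 i) => [|j]; first by rewrite /c ri eqxx.
    rewrite inE /pi xpair_eqE eqb_id /=; apply/andP/eqP => [[/eqP <- /eqP]//|->].
    by rewrite ri eqxx.
  rewrite -[RHS]opprK -sd -sumrN; apply: eq_big => [j|j]; rewrite inE /pi xpair_eqE.
    by case: (rep j =P i) => //= ->; rewrite eqbF_neg.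
  by rewrite /c eqbF_neg => /andP [_ /negPf ->].
have csum' j : \sum_(j' in [set j' | pi j' == pi j]) c j' = 1 by apply: csum.
(* Columns off the representatives are zeroed rather than removed, to keep the index type; the
   columns of [A] are multiples of those of [B], so the rank is still [m]. *)
pose B : 'M[F]_(m, k) := \matrix_(r, i) (A r i *+ (rep i == i)).
have AB r j : A r j = d j * B r (rep j).
  by have /colP/(_ r) := dE j; rewrite !mxE repK eqxx mulr1n.
have Bfree : row_free B.
  rewrite /row_free eqn_leq rank_leq_row /= -{1}(eqP Afree).
  have -> : A = B *m \matrix_(i, j) (d j *+ (i == rep j)).
    apply/matrixP => r j; rewrite !mxE (bigD1 (rep j)) //= big1 => [|i /negPf ir].
      by rewrite mxE eqxx mulr1n addr0 AB mulrC.
    by rewrite mxE ir mulr0n mulr0.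
  exact: mxrankM_maxl.
pose sgn (v : 'I_k -> F) (i : 'I_k * bool) := if i.2 then v i.1 else - v i.1.
have sgnE (mu : 'rV_m) j : (mu *m A) 0 j = sgn (fun i => (mu *m B) 0 i) (pi j) * c j.
  have e : (mu *m A) 0 j = d j * (mu *m B) 0 (rep j).
    rewrite !mxE mulr_sumr; apply: eq_bigr => r _.
    by rewrite AB mulrCA.
  rewrite e /sgn /pi /c /=; case: eqP => [jr|_]; last by rewrite mulrNN mulrC.
  by rewrite mulr1 d1 ?mul1r.
(* Pairs [(i, t)] with [i] not a representative carry no variable, so [lam] must vanish there. *)
have regroup n (p : 'I_k * bool -> 'rV[F]_n) lam :
    (forall i t, lam (i, t) != 0 -> rep i = i) ->
    \sum_j (lam (pi j) * c j) *: p (pi j) = \sum_i lam i *: p i.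
  move=> hlam; rewrite (partition_big pi xpredT) //=; apply: eq_bigr => -[i t] _.
  have [l0|/hlam ri] := eqVneq (lam (i, t)) 0.
    by rewrite big1 ?l0 ?scale0r // => j /eqP ->; rewrite l0 mul0r scale0r.
  transitivity (lam (i, t) *: ((\sum_(j in [set j | pi j == (i, t)]) c j) *: p (i, t))).
    rewrite scaler_suml scaler_sumr; apply: eq_big => [j|j /eqP ->]; first by rewrite inE.
    by rewrite scalerA.
  by rewrite csum // scale1r.
have := refine_forced c0 csum' (duplicated_system_forced R Bfree).
apply: forced_imp => n S [p [x [xS [psol pgen] xp xb]]].
exists x; split=> //; split=> [r|b _ bx].
  have e j : A r j = sgn (B r) (pi j) * c j.
    by have := sgnE (delta_mx 0 r) j; rewrite -!rowE mxE => ->; rewrite /sgn !mxE.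
  under eq_bigr do rewrite e.
  rewrite xp regroup => [|i t]; last first.
    rewrite /sgn /= mxE; case: (rep i =P i) => // _.
    by case: t; rewrite mulr0n ?oppr0 eqxx.
  transitivity (\sum_i (B r i *: p (i, true) - B r i *: p (i, false))); last first.
    by rewrite sumrB psol subrr.
  rewrite (eq_bigr (fun i => \sum_t sgn (B r) (i, t) *: p (i, t))).
    by rewrite pair_bigA; apply: eq_bigr => -[].
  by move=> i _; rewrite big_bool /sgn /= scaleNr.
have [lam bE] := xb (fun j => b 0 j) bx.
(* Off the image of [pi] nothing is known about [lam]; it is set to 0 there because [pgen] sums over
   all indices. *)
pose lam' i := if i \in codom pi then lam i else 0.
have bE' j : b 0 j = lam' (pi j) * c j by rewrite /lam' codom_f.
have [|mu hmu] := pgen lam'.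
  rewrite -regroup => [|i t]; last first.
    rewrite /lam'; case: ifP => [/codomP [j [-> _]] _|_]; first exact: repK.
    by rewrite eqxx.
  by rewrite -xp -[RHS]bx; apply: eq_bigr => j _; rewrite bE'.
apply/submxP; exists mu; apply/rowP => j; rewrite bE' sgnE; congr (_ * _).
by case: (pi j) => i [] /=; rewrite /sgn /=; have [] := hmu i.
Qed.

End ColumnClasses.

Theorem theoremB (R : realType) (F : finFieldType) (m k : nat)
    (A : 'M[F]_(m, k)) :
  typeRC A -> sys_nondegenerate A -> sys_irreducible A ->
  ((forall C, C \in col_classes A -> ~~ class_sums_zero A C) /\
     #|col_classes A| = m.+1
   \/ (forall C, C \in col_classes A -> class_sums_zero A C)) ->
  temperate A R.
Proof.
move=> [bal _] [Afree colnz] _ [[nz ell]|zero].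
  exact: temperate_no_class_sums_zero.
exact: temperate_all_classes_sum_zero.
Qed.
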